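(* Let $d \geq 3$ and let $P$ be the Markov kernel on $\mathbb{S}^{d-1} \times \mathcal{B}(\mathbb{S}^{d-1})$ defined by \[ P(x,A) = \frac{1}{2\pi\,\sigma^{(x)}_{d-2}(\mathbb{S}^{d-2}_x)} \int_{\mathbb{S}^{d-2}_x} \int_0^{2\pi} \mathbb{1}_A\big(\cos(\omega)x + \sin(\omega) z\big)\, \mathrm{d}\omega\, \sigma^{(x)}_{d-2}(\mathrm{d}z), \qquad x \in \mathbb{S}^{d-1},\ A \in \mathcal{B}(\mathbb{S}^{d-1}). \] Then $P$ is Wasserstein contractive with rate \[ \rho := \frac{1}{2\pi} \int_0^{2\pi} \sqrt{\cos^2(\omega) + \frac{\sin^2(\omega)}{d-1}}\; \mathrm{d}\omega, \] i.e. $\mathsf{Dob}(P) \leq \rho$.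
   Context: $\mathbb{S}^{d-1} = \{x \in \mathbb{R}^d : \|x\| = 1\}$ with $\|\cdot\|$ the Euclidean norm, equipped with its Borel $\sigma$-algebra. For $x \in \mathbb{S}^{d-1}$, $\mathbb{S}^{d-2}_x := \{z \in \mathbb{S}^{d-1} : x^T z = 0\}$ is the great subsphere w.r.t. $x$ and $\sigma^{(x)}_{d-2}$ is its natural surface measure. The kernel $P$ is the transition kernel of geodesic slice sampling on the sphere for a constant target density: from $x$, pick $z$ uniformly on $\mathbb{S}^{d-2}_x$, then pick $\omega$ uniformly on $[0,2\pi)$ and move to $\cos(\omega)x+\sin(\omega)z$. For probability measures $\xi_1,\xi_2$ on $\mathbb{S}^{d-1}$, $\mathcal{W}(\xi_1,\xi_2) := \inf_{\gamma} \int \|v_1 - v_2\|\,\gamma(\mathrm{d}v_1\times \mathrm{d}v_2)$, the infimum over all couplings $\gamma$ of $\xi_1,\xi_2$. The Dobrushin coefficient is $\mathsf{Dob}(P) := \sup_{x \neq y \in \mathbb{S}^{d-1}} \mathcal{W}(P(x,\cdot),P(y,\cdot))/\|x-y\|$, and $P$ is called Wasserstein contractive with rate $\rho$ if $\mathsf{Dob}(P) \leq \rho < 1$. *)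

(* Defs.v *)
From HB Require Import structures.
From mathcomp Require Import all_boot all_order all_algebra.
From mathcomp Require Import all_classical all_reals all_analysis.
Set Implicit Arguments. Unset Strict Implicit. Unset Printing Implicit Defensive.
Import Order.TTheory GRing.Theory Num.Theory.
Local Open Scope classical_set_scope.
Local Open Scope ring_scope.

(* Points of R^d are represented as d-tuples of reals; d.-tuple R carries
   the product (= Borel) sigma-algebra from the library. *)
Section Sphere.
Context {R : realType} {d : nat}.
Notation V := (d.-tuple R).

Definition vadd (u v : V) : V := [tuple tnth u i + tnth v i | i < d].
Definition vsub (u v : V) : V := [tuple tnth u i - tnth v i | i < d].
Definition vscale (a : R) (u : V) : V := [tuple a * tnth u i | i < d].
Definition vdot (u v : V) : R := \sum_(i < d) tnth u i * tnth v i.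
Definition vnorm (u : V) : R := Num.sqrt (vdot u u).

Definition sphere : set V := [set x | vnorm x = 1].
Definition subsphere (x : V) : set V := [set z | vnorm z = 1 /\ vdot x z = 0].

Definition mxapply (M : 'M[R]_d) (u : V) : V :=
  [tuple \sum_(j < d) M i j * tnth u j | i < d].

(* [sigma] is, for every x in the sphere, the normalized surface measure
   sigma^{(x)}_{d-2} / sigma^{(x)}_{d-2}(S^{d-2}_x) on the great subsphere,
   i.e. the (unique) probability measure concentrated on S^{d-2}_x that is
   invariant under all orthogonal transformations fixing x. *)
Definition normalized_subsphere_measures
    (sigma : V -> probability V R) : Prop :=
  forall x, sphere x ->
    sigma x (subsphere x) = 1%E /\
    forall M : 'M[R]_d, M^T *m M = 1%:M -> mxapply M x = x ->
      forall A : set V, measurable A ->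
        sigma x (mxapply M @^-1` A) = sigma x A.

(* geodesic slice sampling kernel for constant target:
   P(x,A) = 1/(2 pi) \int_{S_x} \int_0^{2pi} 1_A(cos w x + sin w z) dw dsigma_x(z)
   (sigma x already normalized). *)
Definition gss_kernel (sigma : V -> probability V R) (x : V) (A : set V)
    : \bar R :=
  ((2 * pi)^-1)%:E *
  \int[sigma x]_z
     (\int[lebesgue_measure]_(w in `[0%R, (2 * pi)%R[)
        (\1_A (vadd (vscale (cos w) x) (vscale (sin w) z)) : R)%:E).

Definition couplings (mu nu : set V -> \bar R) : set (probability (V * V)%type R) :=
  [set g | forall A : set V, measurable A ->
       g (A `*` setT) = mu A /\ g (setT `*` A) = nu A].

Definition wasserstein (mu nu : set V -> \bar R) : \bar R :=
  ereal_inf [set (\int[g]_p (vnorm (vsub p.1 p.2))%:E)%E | g in couplings mu nu].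

Definition dobrushin (P : V -> set V -> \bar R) : \bar R :=
  ereal_sup [set r | exists x y, sphere x /\ sphere y /\ x <> y /\
     r = (wasserstein (P x) (P y) * ((vnorm (vsub x y))^-1)%:E)%E].

Definition wasserstein_contractive (P : V -> set V -> \bar R) (rho : \bar R)
  : Prop := (dobrushin P <= rho)%E /\ (rho < 1)%E.

End Sphere.

Definition gss_rate {R : realType} (d : nat) : \bar R :=
  (((2 * pi)^-1)%:E *
   \int[@lebesgue_measure R]_(w in `[0%R, (2 * pi)%R[)
      (Num.sqrt (cos w ^+ 2 + sin w ^+ 2 / (d%:R - 1)))%:E)%E.

(* Main.v *)
Require Import Defs.
From HB Require Import structures.
From mathcomp Require Import all_boot all_order all_algebra.
From mathcomp Require Import all_classical all_reals all_analysis.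
From mathcomp Require Import measurable_realfun ring lra.
Import Order.TTheory GRing.Theory Num.Theory numFieldNormedType.Exports.
Local Open Scope classical_set_scope.
Local Open Scope ring_scope.

(** Let M be the rotation of the plane containing x and y that sends x to y.
    If z is uniform on the great subsphere of x, then M z is uniform on that
    of y, so following the two geodesics with the same angle w, one in
    direction z and the other in direction M z, couples P(x, .) and P(y, .).
    With e the unit vector orthogonal to x in that plane, the distance between
    the endpoints is |x - y| sqrt(cos^2 w + sin^2 w <e, z>^2).  By symmetry
    <e, z>^2 has mean 1 / (d - 1), and Jensen's inequality in z gives the rate.

    That M transports one surface measure to the other rests on the uniqueness
    of a reflection-invariant probability measure on a great subsphere: for
    two such measures mu and nu, the mass of a ball does not depend on its
    center, so integrating the indicator of {|z - u| < r} against mu x nu in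
    both orders shows first that the two ball masses agree, then that
    mu(A) <= nu(A^r) for the r-neighbourhood A^r of A; let r tend to 0 for
    A a closed box. *)

(** * Inner product and reflections *)

Section InnerProduct.
Context {R : realType} {d : nat}.
Local Notation V := (d.-tuple R).
Implicit Types (u v n x y : V) (a : R).

Lemma vdotC u v : vdot u v = vdot v u.
Proof. by apply: eq_bigr => i _; rewrite mulrC. Qed.

Lemma vdotDl u v n : vdot (vadd u v) n = vdot u n + vdot v n.
Proof. by rewrite -big_split; apply: eq_bigr => i _; rewrite tnth_mktuple mulrDl. Qed.

Lemma vdotBl u v n : vdot (vsub u v) n = vdot u n - vdot v n.
Proof. by rewrite -sumrB; apply: eq_bigr => i _; rewrite tnth_mktuple mulrBl. Qed.

Lemma vdotZl a u n : vdot (vscale a u) n = a * vdot u n.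
Proof. by rewrite mulr_sumr; apply: eq_bigr => i _; rewrite tnth_mktuple mulrA. Qed.

Lemma vdotDr u v n : vdot n (vadd u v) = vdot n u + vdot n v.
Proof. by rewrite vdotC vdotDl !(vdotC n). Qed.

Lemma vdotBr u v n : vdot n (vsub u v) = vdot n u - vdot n v.
Proof. by rewrite vdotC vdotBl !(vdotC n). Qed.

Lemma vdotZr a u n : vdot n (vscale a u) = a * vdot n u.
Proof. by rewrite vdotC vdotZl vdotC. Qed.

Definition vdotE := (vdotDl, vdotBl, vdotZl, vdotDr, vdotBr, vdotZr).

Lemma vdot_sub u v :
  vdot (vsub u v) (vsub u v) = vdot u u - 2 * vdot u v + vdot v v.
Proof. by rewrite !vdotE (vdotC v u); ring. Qed.

Lemma vdotvv_ge0 u : 0 <= vdot u u.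
Proof. by apply: sumr_ge0 => i _; rewrite -expr2 sqr_ge0. Qed.

Lemma sqr_tnth_le u i : tnth u i ^+ 2 <= vdot u u.
Proof.
rewrite /vdot (bigD1 i)//= -expr2 lerDl.
by apply: sumr_ge0 => j _; rewrite -expr2 sqr_ge0.
Qed.

Lemma vdotvv_eq0 u : vdot u u = 0 -> forall v, vdot u v = 0.
Proof.
move=> u0 v; apply: big1 => i _; have := sqr_tnth_le u i.
rewrite u0 => h; have : tnth u i ^+ 2 == 0 by rewrite eq_le h sqr_ge0.
by rewrite sqrf_eq0 => /eqP ->; rewrite mul0r.
Qed.

Lemma vsub_eq0 u v : vdot (vsub u v) (vsub u v) = 0 -> u = v.
Proof.
move=> h; apply: eq_from_tnth => i; apply/eqP.
have := sqr_tnth_le (vsub u v) i.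
by rewrite h tnth_mktuple -subr_eq0 -sqrf_eq0 eq_le => ->; rewrite sqr_ge0.
Qed.

Lemma vnorm1 u : vnorm u = 1 <-> vdot u u = 1.
Proof.
rewrite /vnorm; split=> [h|->]; last by rewrite sqrtr1.
by rewrite -[LHS]sqr_sqrtr ?vdotvv_ge0// h expr1n.
Qed.

Lemma subsphereP x z : subsphere x z <-> vdot z z = 1 /\ vdot x z = 0.
Proof. by split=> -[/vnorm1]. Qed.

(** The Householder reflection in the hyperplane orthogonal to [n]. For [n = 0] the convention that
    the inverse of 0 is 0 makes it the identity. *)
Definition reflection n u : V := vsub u (vscale (2 * vdot n u / vdot n n) n).

Lemma vdot_reflection n u v : vdot (reflection n u) (reflection n v) = vdot u v.
Proof.
have [n0|n0] := eqVneq (vdot n n) 0.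
  by rewrite /reflection !vdotE n0 !(vdotvv_eq0 n n0) invr0; ring.
by rewrite /reflection !vdotE (vdotC u n) ; field.
Qed.

Lemma reflection_fix n u : vdot n u = 0 -> reflection n u = u.
Proof.
by move=> h; apply: eq_from_tnth => i; rewrite !tnth_mktuple h; ring.
Qed.

Lemma reflectionK n : involutive (reflection n).
Proof.
move=> u; apply: vsub_eq0.
rewrite vdot_sub !vdot_reflection.
have [n0|n0] := eqVneq (vdot n n) 0.
  by rewrite !(reflection_fix n) ?(vdotvv_eq0 n n0)//; ring.
by rewrite /reflection !vdotE; field.
Qed.

(** Vectors of equal length are mirror images in the hyperplane that bisects them. Every symmetry
    used below comes from this one: it fixes whatever is orthogonal to [x - y]. *)
Lemma reflection_swap x y : vdot x x = vdot y y -> reflection (vsub x y) x = y.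
Proof.
move=> xy.
have [n0|n0] := eqVneq (vdot (vsub x y) (vsub x y)) 0.
  by rewrite (vsub_eq0 _ _ n0) reflection_fix // !vdotE subrr.
apply: eq_from_tnth => i; rewrite !tnth_mktuple.
move: n0; rewrite !vdotE (vdotC y x) -xy => n0; field; move: n0.
by apply: contraNN => /eqP h; apply/eqP; rewrite -h; ring.
Qed.

Lemma vdot_reflectionl n u v : vdot (reflection n u) v = vdot u (reflection n v).
Proof. by rewrite -(vdot_reflection n) reflectionK. Qed.

Lemma vsub_reflection n u v : vsub (reflection n u) (reflection n v) = reflection n (vsub u v).
Proof. by apply: eq_from_tnth => i; rewrite !tnth_mktuple !vdotE; ring. Qed.

(** Conjugating a reflection by an isometry reflects along the image of the normal vector. *)
Lemma reflection_conj n m u :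
  reflection (reflection n m) (reflection n u) = reflection n (reflection m u).
Proof.
rewrite {1}/reflection !vdot_reflection.
by apply: eq_from_tnth => i; rewrite !tnth_mktuple !vdotE; ring.
Qed.

(** Bridge to the hypothesis on [sigma], which speaks of orthogonal matrices: the matrix is I - 2 n
    n^T / <n, n>. *)
Lemma reflection_mxapply n :
  exists2 M : 'M[R]_d, M^T *m M = 1%:M & mxapply M =1 reflection n.
Proof.
pose M : 'M[R]_d :=
  \matrix_(i, j) ((i == j)%:R - 2 * tnth n i * tnth n j / vdot n n).
have sum_delta (i : 'I_d) (f : 'I_d -> R) : \sum_j (i == j)%:R * f j = f i.
  rewrite (bigD1 i)//= eqxx mul1r big1 ?addr0// => j.
  by rewrite eq_sym => /negbTE->; rewrite mul0r.
have ME : mxapply M =1 reflection n.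
  move=> u; apply: eq_from_tnth => i; rewrite !tnth_mktuple.
  under eq_bigr do rewrite mxE mulrBl.
  rewrite sumrB sum_delta; congr (_ - _).
  rewrite /vdot mulrAC mulr_sumr !mulr_suml; apply: eq_bigr => j _; rewrite -/(vdot n n).
  by ring.
exists M => //; apply/matrixP => i j; rewrite !mxE.
(* Preservation of the inner product, evaluated at the basis vectors i and j, is the (i, j) entry of
   M^T M = 1. *)
have := vdot_reflection n [tuple (k == i)%:R | k < d] [tuple (k == j)%:R | k < d].
rewrite -!ME /vdot.
have col (k l : 'I_d) : tnth (mxapply M [tuple (p == k)%:R | p < d]) l = M l k.
  rewrite tnth_mktuple -[RHS](sum_delta k (M l)).
  by apply: eq_bigr => p _; rewrite tnth_mktuple mulrC eq_sym.
under eq_bigr do rewrite !col.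
under [RHS]eq_bigr do rewrite !tnth_mktuple [in X in X * _]eq_sym.
by rewrite sum_delta => <-; apply: eq_bigr => p _; rewrite !mxE.
Qed.
End InnerProduct.

(** * Measurability and boxes *)

Section Measurability.
Context {R : realType} {d : nat} {dT} {T : measurableType dT}.
Local Notation V := (d.-tuple R).
Implicit Types (f g : T -> V).

Lemma measurable_coord f i :
  measurable_fun setT f -> measurable_fun setT (fun t => tnth (f t) i).
Proof. by move=> mf; have /(_ i) := (measurable_fun_tnthP f).1 mf. Qed.

Lemma measurable_vdot f g : measurable_fun setT f -> measurable_fun setT g ->
  measurable_fun setT (fun t => vdot (f t) (g t)).
Proof.
by move=> mf mg; apply: measurable_sum => i; apply: measurable_funM; apply: measurable_coord.
Qed.

Lemma measurable_vadd f g : measurable_fun setT f -> measurable_fun setT g ->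
  measurable_fun setT (fun t => vadd (f t) (g t)).
Proof.
move=> mf mg; apply/measurable_fun_tnthP => i.
apply: (eq_measurable_fun (fun t => tnth (f t) i + tnth (g t) i)).
  by move=> t _ /=; rewrite tnth_mktuple.
by apply: measurable_funD; apply: measurable_coord.
Qed.

Lemma measurable_vsub f g : measurable_fun setT f -> measurable_fun setT g ->
  measurable_fun setT (fun t => vsub (f t) (g t)).
Proof.
move=> mf mg; apply/measurable_fun_tnthP => i.
apply: (eq_measurable_fun (fun t => tnth (f t) i - tnth (g t) i)).
  by move=> t _ /=; rewrite tnth_mktuple.
by apply: measurable_funB; apply: measurable_coord.
Qed.

Lemma measurable_vscale (a : T -> R) f :
  measurable_fun setT a -> measurable_fun setT f ->
  measurable_fun setT (fun t => vscale (a t) (f t)).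
Proof.
move=> ma mf; apply/measurable_fun_tnthP => i.
apply: (eq_measurable_fun (fun t => a t * tnth (f t) i)).
  by move=> t _ /=; rewrite tnth_mktuple.
by apply: measurable_funM => //; apply: measurable_coord.
Qed.

Lemma measurable_reflection (n : V) f : measurable_fun setT f ->
  measurable_fun setT (fun t => reflection n (f t)).
Proof.
move=> mf; apply: measurable_vsub => //; apply: measurable_vscale => //.
by apply: measurable_funM => //; apply: measurable_funM => //; apply: measurable_vdot.
Qed.

End Measurability.

Section Boxes.
Context {R : realType} {d : nat}.
Local Notation V := (d.-tuple R).

(** Extended real corners let half-spaces and the whole space count as boxes; boxes are then a
    pi-system. *)
Definition box (a : 'I_d -> \bar R) : set V :=
  [set z | forall i, ((tnth z i)%:E <= a i)%E].

Lemma measurable_box a : measurable (box a).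
Proof.
have -> : box a = \bigcap_(i in setT) [set z : V | ((tnth z i)%:E <= a i)%E].
  by apply/seteqP; split=> z h i //=; apply: h.
apply: fin_bigcap_measurable => // i _.
rewrite -[X in measurable X]setTI; apply: emeasurable_fun_infty_c => //.
by apply/measurable_EFinP; apply: measurable_coord.
Qed.

(** It suffices that every coordinate is measurable for the sigma-algebra generated by boxes. The
    preimage of an open ray is the complement of a box with a single finite bound. *)
Lemma measurable_box_generated :
  @measurable _ V `<=` <<s range box >>.
Proof.
pose P : pointedType := HB.pack V (isPointed.Build V [tuple 0 | _ < d]).
pose G : set (set P) := range box.
pose S : measurableType G.-sigma := g_sigma_algebraType G.
have mid : @measurable_fun _ _ S V setT id.
  apply/measurable_fun_tnthP => i.
  apply: (measurability _ (RGenOInfty.measurableE R)) => //.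
  move=> _ [_ [a ->] <-]; rewrite setTI.
  rewrite -[X in measurable X]setCK; apply: measurableC.
  apply: (@sub_sigma_algebra _ setT (range box)).
  exists (fun j => if j == i then a%:E else +oo%E) => //.
  apply/seteqP; split=> z /=; rewrite in_itv/= andbT.
    by move=> /(_ i); rewrite eqxx lee_fin leNgt => /negP.
  move=> /negP; rewrite -leNgt => h j; case: eqP => [->|_]; first by rewrite lee_fin.
  by rewrite leey.
by move=> A mA; have h := mid measurableT A mA; rewrite setTI in h; exact: h.
Qed.

Lemma box_measure_unique (mu nu : probability V R) :
  (forall a, mu (box a) = nu (box a)) -> forall A, measurable A -> mu A = nu A.
Proof.
move=> h A mA.
apply: (g_sigma_algebra_measure_unique (range box) _ (fun=> setT)) => //.
- by move=> _ [a _ <-]; exact: measurable_box.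
- by move=> i; exists (fun=> +oo%E) => //; apply/seteqP; split=> // z _ j; rewrite leey.
- by rewrite bigcup_const//; exists 0%N.
- move=> _ _ [a _ <-] [b _ <-]; exists (fun i => Order.min (a i) (b i)) => //.
  apply/seteqP; split=> z.
    by move=> h'; split=> i; have := h' i; rewrite le_min => /andP[].
  by move=> [ha hb] i; rewrite le_min ha hb.
- by move=> _ [a _ <-]; exact: h.
- by move=> k; rewrite /= probability_setT ltry.
- exact: measurable_box_generated.
Qed.

End Boxes.

(** * Reflection-invariant measures on a great subsphere *)

Section ReflectionInvariance.
Context {R : realType} {d : nat}.
Local Notation V := (d.-tuple R).
Implicit Types (x y z u : V) (mu nu : probability V R).

Lemma measurable_subsphere x : measurable (subsphere x).
Proof.
have -> : subsphere x = (fun z => vdot z z) @^-1` [set 1] `&`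
    (fun z => vdot x z) @^-1` [set 0] by apply/seteqP; split=> z /subsphereP.
by apply: measurableI; rewrite -[X in measurable X]setTI;
  apply: measurable_vdot => //; exact: measurable_set1.
Qed.

(** Reflections along normals orthogonal to [x] fix [x], and by [reflection_swap] they already act
    transitively on the great subsphere. *)
Definition reflection_invariant x mu : Prop :=
  mu (subsphere x) = 1%E /\
  forall n, vdot n x = 0 -> forall A, measurable A ->
    mu (reflection n @^-1` A) = mu A.

Lemma full_measureI (mu : probability V R) (S A : set V) :
  measurable S -> measurable A -> mu S = 1%E -> mu (A `&` S) = mu A.
Proof.
move=> mS mA S1.
have SC : mu (~` S) = 0%E by rewrite probability_setC// S1 subee.
rewrite [RHS](measureDI mu mA mS) [X in (X + _)%E](_ : _ = 0%E) ?add0e//.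
by apply: (subset_measure0 _ _ _ SC) => //; [exact: measurableD|exact: measurableC].
Qed.

(** The parameter [r] bounds the squared distance. *)
Definition ball2 (r : R) z : set V := [set u | vdot (vsub z u) (vsub z u) < r].

Lemma measurable_dist2_lt (r : R) :
  measurable [set p : V * V | vdot (vsub p.1 p.2) (vsub p.1 p.2) < r].
Proof.
rewrite (_ : mkset _ = (fun p : V * V => vdot (vsub p.1 p.2) (vsub p.1 p.2)) @^-1`
    `]-oo, r[); last by apply/seteqP; split=> p /=; rewrite in_itv.
rewrite -[X in measurable X]setTI.
by apply: measurable_vdot; [exact: measurable_vsub..| |exact: measurable_itv].
Qed.

Lemma measurable_ball2 r z : measurable (ball2 r z).
Proof.
rewrite (_ : ball2 r z = xsection [set p : V * V | vdot (vsub p.1 p.2) (vsub p.1 p.2) < r] z).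
  by apply: measurable_xsection; exact: measurable_dist2_lt.
by apply/seteqP; split=> u /=; rewrite /xsection /= inE.
Qed.

Lemma ball2_sym r z u : ball2 r z u = ball2 r u z.
Proof. by rewrite /ball2 /= !vdot_sub (vdotC z u); congr (is_true (_ < _)); ring. Qed.

(** The reflection along [z1 - z2] fixes [y] and exchanges the two balls. *)
Lemma measure_ball2 y mu r z1 z2 : reflection_invariant y mu ->
  subsphere y z1 -> subsphere y z2 -> mu (ball2 r z1) = mu (ball2 r z2).
Proof.
move=> [_ inv] /subsphereP[z11 yz1] /subsphereP[z22 yz2].
rewrite -(inv (vsub z1 z2) _ (ball2 r z2)); last 2 first.
- by rewrite vdotBl !(vdotC _ y) yz1 yz2 subrr.
- exact: measurable_ball2.
congr (mu _); apply/seteqP; split => u /=;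
  by rewrite /ball2 /= -{1 3}(reflection_swap z1 z2 _) ?z11 ?z22// vsub_reflection vdot_reflection.
Qed.

(** If one ball centered on the subsphere were null, all of that radius would be, and countably many
    pieces, each inside such a ball, cover the subsphere. *)
Lemma measure_ball2_gt0 y mu r z : 0 < r -> reflection_invariant y mu ->
  subsphere y z -> (0 < mu (ball2 r z))%E.
Proof.
move=> r0 inv Sz; rewrite lt0e measure_ge0 andbT; apply/eqP => mz.
(* A cube of side [e] has squared diameter d r / (d + 1), which is strictly below [r]. *)
pose e := Num.sqrt (r / d.+1%:R).
have e0 : 0 < e by rewrite sqrtr_gt0 divr_gt0// ltr0n.
have e2 : e ^+ 2 *+ d < r.
  rewrite sqr_sqrtr ?divr_ge0 ?ltW// -mulr_natr -mulrA gtr_pMr//.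
  by rewrite mulrC ltr_pdivrMr ?ltr0n// mul1r ltr_nat.
(* The grid of side [e] cuts the subsphere into cells indexed by integer tuples, a countable type. A
   nonempty cell lies in the ball around any of its points. *)
pose cell (c : d.-tuple int) : set V :=
  [set u | subsphere y u /\ forall i, Num.floor (tnth u i / e) = tnth c i].
have cell0 c : mu.-negligible (cell c).
  have [->|/set0P[v [Sv vc]]] := eqVneq (cell c) set0; first exact: negligible_set0.
  exists (ball2 r v); split; first exact: measurable_ball2.
    by rewrite (measure_ball2 y mu r v z inv Sv Sz).
  move=> u [Su uc]; rewrite /ball2 /=; apply: le_lt_trans e2.
  rewrite -[X in _ <= _ *+ X]card_ord -sumr_const; apply: ler_sum => i _.
  rewrite tnth_mktuple -expr2.
  have ve := vc i; have ue := uc i.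
  have /andP[v1 v2] := Num.Theory.floor_itv (tnth v i / e).
  have /andP[u1 u2] := Num.Theory.floor_itv (tnth u i / e).
  move: v1 v2 u1 u2; rewrite ve ue intrD -[1%:~R]/(1 : R) ler_pdivlMr// ltr_pdivrMr//.
  rewrite ler_pdivlMr// ltr_pdivrMr// !mulrDl mul1r => v1 v2 u1 u2.
  rewrite -real_normK ?num_real// lerXn2r ?nnegrE//; first exact: ltW.
  by rewrite ler_norml; apply/andP; split; lra.
have : mu.-negligible (subsphere y).
  rewrite (_ : subsphere y = \bigcup_n (if unpickle n is Some c then cell c else set0)).
    by apply: negligible_bigcup => n; case: unpickle => // *; exact: negligible_set0.
  apply/seteqP; split => [u Su|u [n _]]; last by case: unpickle => // c [].
  exists (pickle [tuple Num.floor (tnth u i / e) | i < d]) => //.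
  by rewrite pickleK; split=> // i; rewrite tnth_mktuple.
move=> /(negligibleP _ (measurable_subsphere y)) S0; have := inv.1.
by rewrite [LHS]S0 => /esym/eqP; rewrite onee_eq0.
Qed.

Lemma integral_cst_indic (mu : probability V R) (c : \bar R) B :
  (0 <= c)%E -> measurable B -> (\int[mu]_z (c * (\1_B z)%:E) = c * mu B)%E.
Proof.
move=> c0 mB; rewrite ge0_integralZl//; last first.
  by apply/measurable_EFinP; exact: measurable_indic.
by rewrite integral_indic// setIT.
Qed.

(** Let [K] consist of the pairs of subsphere points (z, u) at squared distance below [r] with z in
    [A], and compute its product measure in both orders. The slice at z in [A] has the constant mass
    [nu (ball2 r z0)]. The slice at u is empty unless u is in [A'], and lies in a ball of mass
    [mu (ball2 r z0)]. *)
Lemma measure_ball2_compare y mu nu r z0 (A A' : set V) :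
  reflection_invariant y mu -> reflection_invariant y nu -> subsphere y z0 ->
  measurable A -> measurable A' ->
  (forall z u, A z -> ball2 r z u -> A' u) ->
  (nu (ball2 r z0) * mu A <= mu (ball2 r z0) * nu A')%E.
Proof.
move=> imu inu Sz0 mA mA' AA'.
set S := subsphere y; have mS : measurable S by exact: measurable_subsphere.
pose K := ((A `&` S) `*` S) `&`
  [set p : V * V | vdot (vsub p.1 p.2) (vsub p.1 p.2) < r].
have mK : measurable K.
  apply: measurableI; last exact: measurable_dist2_lt.
  by apply: measurableX => //; exact: measurableI.
have := @indic_fubini_tonelli _ _ _ _ _ mu nu K mK.
rewrite indic_fubini_tonelli_FE// indic_fubini_tonelli_GE//.
rewrite -(full_measureI mu S A)//; last exact: imu.1.
rewrite -(full_measureI nu S A')//; last exact: inu.1.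
rewrite -!integral_cst_indic//; try exact: measurableI.
have -> : (\int[mu]_z (nu (ball2 r z0) * (\1_(A `&` S) z)%:E) =
    \int[mu]_z (nu \o xsection K) z)%E.
  apply: eq_integral => z _ /=; rewrite indicE.
  have [/set_mem zAS|/negP zAS] := boolP (z \in A `&` S).
    rewrite mule1 (measure_ball2 y nu r z0 z inu Sz0 zAS.2).
    rewrite -(full_measureI nu S (ball2 r z))//; [|exact: measurable_ball2|exact: inu.1].
    congr (nu _); apply/seteqP; split => u /=; rewrite /xsection/= inE.
      by move=> [? ?]; split.
    by move=> [[_ ?] ?]; split.
  rewrite mule0 (_ : xsection K z = set0) ?measure0//.
  apply/seteqP; split => u //=; rewrite /xsection/= inE => -[[zA _] _].
  by have := zAS (mem_set zA).
move=> ->; apply: ge0_le_integral => //.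
- exact: measurable_fun_ysection.
- apply: measurable_funeM; apply/measurable_EFinP/measurable_indic.
  exact: measurableI.
move=> u _ /=; rewrite indicE.
have [/set_mem uAS|/negP uAS] := boolP (u \in A' `&` S).
  rewrite mule1 (measure_ball2 y mu r z0 u imu Sz0 uAS.2).
  apply: le_measure; rewrite ?inE; [exact: measurable_ysection|exact: measurable_ball2|].
  move=> z; rewrite /ysection/= inE ball2_sym => -[_]; exact.
rewrite mule0 (_ : ysection K u = set0) ?measure0//.
apply/seteqP; split => z //=; rewrite /ysection/= inE => -[[[/= zA _] Su] zu].
by apply: (uAS (mem_set _)); split => //; exact: AA' zA zu.
Qed.

End ReflectionInvariance.

(** * Uniqueness of the invariant measure *)

Section Uniqueness.
Context {R : realType} {d : nat}.
Local Notation V := (d.-tuple R).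
Implicit Types (x y z u : V) (mu nu : probability V R).

Lemma ball2_coord e z u i : 0 < e -> ball2 (e ^+ 2) z u ->
  tnth u i <= tnth z i + e.
Proof.
rewrite /ball2 /= => e0; have := sqr_tnth_le (vsub z u) i.
rewrite tnth_mktuple => /le_lt_trans /[apply].
by move=> h; rewrite leNgt; apply/negP => zu; nra.
Qed.

Lemma reflection_invariant_box_le y mu nu :
  reflection_invariant y mu -> reflection_invariant y nu ->
  forall a, (mu (box a) <= nu (box a))%E.
Proof.
move=> imu inu a.
have [S0|/set0P[z0 Sz0]] := eqVneq (subsphere y) set0.
  by have := imu.1; rewrite S0 measure0 => /esym/eqP; rewrite onee_eq0.
(* Comparing the whole space with itself, in both directions, shows that the ball masses agree. *)
have ballE r : mu (ball2 r z0) = nu (ball2 r z0).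
  have := measure_ball2_compare y mu nu r z0 setT setT imu inu Sz0 measurableT measurableT.
  have := measure_ball2_compare y nu mu r z0 setT setT inu imu Sz0 measurableT measurableT.
  rewrite !probability_setT !mule1 => h1 h2.
  by apply/eqP; rewrite eq_le h1// h2.
(* Enlarging each bound by 1 / (n + 1) gives a box containing the neighbourhood of that radius;
   infinite bounds stay as they are. *)
pose b n i := (a i + n.+1%:R^-1%:E)%E.
have le_b n : (mu (box a) <= nu (box (b n)))%E.
  pose e : R := n.+1%:R^-1.
  have e0 : 0 < e by rewrite invr_gt0 ltr0n.
  have := measure_ball2_compare y mu nu (e ^+ 2) z0 _ _ imu inu Sz0
    (measurable_box a) (measurable_box (b n)).
  rewrite ballE lee_pmul2l ?fin_num_measure//; first last.
  - by apply: (measure_ball2_gt0 y) => //; rewrite exprn_gt0.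
  - exact: measurable_ball2.
  apply => z u az /ball2_coord zu i; apply: (@le_trans _ _ (tnth z i + e)%:E).
    by rewrite lee_fin zu.
  by rewrite EFinD leeD.
(* The box is closed, so it is the decreasing intersection of its enlargements, and [nu] is
   continuous from above. *)
rewrite [X in (_ <= nu X)%E](_ : box a = \bigcap_n box (b n)); last first.
  apply/seteqP; split=> [z az n _ i|z bz i].
    by apply: (le_trans (az i)); rewrite leeDl// lee_fin invr_ge0.
  apply/lee_addgt0Pr => e e0; have [n] := ltr_add_invr e0; rewrite add0r => ne.
  by apply: (le_trans (bz n Logic.I i)); rewrite leeD// lee_fin ltW.
apply: (@cvge_ge _ \oo _ R (nu \o (fun n => box (b n)))).
  by apply: nearW => n /=; exact: le_b.
apply: nonincreasing_cvg_mu.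
- by rewrite ltey_eq fin_num_measure//; exact: measurable_box.
- by move=> n; exact: measurable_box.
- by apply: bigcapT_measurable => n; exact: measurable_box.
- move=> m n mn; apply/subsetPset => z bz i; apply: (le_trans (bz i)).
  by rewrite leeD// lee_fin lef_pV2 ?posrE ?ltr0n// ler_nat.
Qed.

Lemma reflection_invariant_unique y mu nu :
  reflection_invariant y mu -> reflection_invariant y nu ->
  forall A, measurable A -> mu A = nu A.
Proof.
move=> imu inu; apply: box_measure_unique => a.
by apply/eqP; rewrite eq_le !(reflection_invariant_box_le y).
Qed.

End Uniqueness.

(** * Transport between great subspheres *)

Section Transport.
Context {R : realType} {d : nat}.
Local Notation V := (d.-tuple R).

(** By uniqueness it is enough that the image of [mu] is invariant for [y]. A reflection along [m]
    orthogonal to [y] pulls back to the reflection along [reflection n m], which is orthogonal to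
    [x]. *)
Lemma reflection_transport (x y : V) (mu nu : probability V R) :
  vdot x x = vdot y y ->
  reflection_invariant x mu -> reflection_invariant y nu ->
  forall A, measurable A -> mu (reflection (vsub x y) @^-1` A) = nu A.
Proof.
move=> xy imu inu A mA; set n := vsub x y.
have mrefl m : measurable_fun setT (reflection m : V -> V).
  exact: measurable_reflection.
have mpre m B : measurable B -> measurable (reflection m @^-1` B : set V).
  by move=> mB; rewrite -[X in measurable X]setTI; exact: mrefl.
pose f : {mfun V >-> V} := HB.pack (reflection n : V -> V)
  (isMeasurableFun.Build _ _ _ _ _ (mrefl n)).
have nx : reflection n x = y by exact: reflection_swap.
have ny : reflection n y = x by rewrite -nx reflectionK.
apply: (reflection_invariant_unique y (distribution mu f) nu) => //.
split.
  change (mu (reflection n @^-1` subsphere y) = 1%E).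
  rewrite (_ : _ @^-1` _ = subsphere x); first exact: imu.1.
  by apply/seteqP; split => u /=;
    rewrite !subsphereP vdot_reflection -{1}nx vdot_reflection.
move=> m my B mB.
change (mu (reflection n @^-1` (reflection m @^-1` B)) = mu (reflection n @^-1` B)).
rewrite -[RHS](imu.2 (reflection n m)); last 2 first.
- by rewrite vdot_reflectionl nx.
- exact: mpre.
congr (mu _); apply/seteqP; split => u /=;
  by rewrite -(reflection_conj n (reflection n m)) reflectionK.
Qed.

End Transport.

(** * Second moment *)

Section SecondMoment.
Context {R : realType} {d : nat}.
Local Notation V := (d.-tuple R).
Implicit Types (x u v e : V) (mu : probability V R).

Lemma integral_full mu (S : set V) (f : V -> \bar R) :
  measurable S -> mu S = 1%E -> measurable_fun setT f -> (forall z, 0 <= f z)%E ->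
  (\int[mu]_z f z = \int[mu]_(z in S) f z)%E.
Proof.
move=> mS S1 mf f0.
have SC : mu (~` S) = 0%E by rewrite probability_setC// S1 subee.
rewrite (ge0_negligible_integral _ _ _ _ SC)//; last exact: measurableC.
by rewrite setDE setCK setTI.
Qed.

Lemma measurable_sqr_vdot u : measurable_fun setT (fun z : V => ((vdot u z) ^+ 2)%:E).
Proof. by apply/measurable_EFinP; apply: measurable_funX; apply: measurable_vdot. Qed.

(** The reflection along [u - v] exchanges [u] and [v] and preserves [mu], because it fixes [x]. *)
Lemma second_moment_eq mu x u v : reflection_invariant x mu ->
  vdot u x = 0 -> vdot v x = 0 -> vdot u u = vdot v v ->
  (\int[mu]_z ((vdot u z) ^+ 2)%:E = \int[mu]_z ((vdot v z) ^+ 2)%:E)%E.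
Proof.
move=> inv ux vx uv; set n := vsub u v.
have mrefl : measurable_fun setT (reflection n : V -> V) by exact: measurable_reflection.
rewrite -(reflection_swap u v uv) -/n.
under [RHS]eq_integral do rewrite vdot_reflectionl.
transitivity (\int[pushforward mu (reflection n)]_z ((vdot u z) ^+ 2)%:E)%E.
  apply: eq_measure_integral => A mA _; rewrite -[LHS](inv.2 n) //.
  by rewrite vdotBl ux vx subrr.
rewrite ge0_integral_pushforward//; first exact: measurable_sqr_vdot.
by move=> z _; rewrite lee_fin sqr_ge0.
Qed.

(** Let p_i be the projection of the i-th basis vector to the orthogonal complement of [x]. On the
    subsphere <p_i, z> is the coordinate z_i, so the squares sum to 1. By symmetry and scaling the
    i-th square has mean (1 - x_i^2) Q, and these factors sum to d - 1. *)
Lemma second_moment mu x e : (2 <= d)%N -> reflection_invariant x mu ->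
  vdot x x = 1 -> vdot e x = 0 -> vdot e e = 1 ->
  (\int[mu]_z ((vdot e z) ^+ 2)%:E = ((d%:R - 1)^-1)%:E)%E.
Proof.
move=> d2 inv xx ex ee.
pose p i : V := vsub [tuple (k == i)%:R | k < d] (vscale (tnth x i) x).
have p_dot i (z : V) : vdot (p i) z = tnth z i - tnth x i * vdot x z.
  rewrite vdotBl vdotZl; congr (_ - _).
  rewrite /vdot (bigD1 i)//= tnth_mktuple eqxx mul1r big1 ?addr0// => j ji.
  by rewrite tnth_mktuple (negbTE ji) mul0r.
have px i : vdot (p i) x = 0 by rewrite p_dot xx mulr1 subrr.
have pp i : vdot (p i) (p i) = 1 - tnth x i ^+ 2.
  by rewrite p_dot (vdotC x) px mulr0 subr0 !tnth_mktuple eqxx expr2.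
set Q := (\int[mu]_z _)%E.
have Qp i : (\int[mu]_z ((vdot (p i) z) ^+ 2)%:E = (1 - tnth x i ^+ 2)%:E * Q)%E.
  have xi : 0 <= 1 - tnth x i ^+ 2 by rewrite subr_ge0 -xx sqr_tnth_le.
  rewrite (second_moment_eq mu x _ (vscale (Num.sqrt (1 - tnth x i ^+ 2)) e))//.
  - under eq_integral do rewrite vdotZl exprMn sqr_sqrtr// EFinM.
    rewrite ge0_integralZl//; first exact: measurable_sqr_vdot.
    by move=> z _; rewrite lee_fin sqr_ge0.
  - by rewrite vdotZl ex mulr0.
  - by rewrite vdotZl vdotZr ee mulr1 pp -expr2 sqr_sqrtr.
have Q0 : (0 <= Q)%E by apply: integral_ge0 => z _; rewrite lee_fin sqr_ge0.
have : (\sum_(i < d) \int[mu]_z ((vdot (p i) z) ^+ 2)%:E = 1)%E.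
  rewrite -ge0_integral_sum//; last 2 first.
  - by move=> i; exact: measurable_sqr_vdot.
  - by move=> i z _; rewrite lee_fin sqr_ge0.
  rewrite (integral_full mu (subsphere x))//; last 4 first.
  - exact: measurable_subsphere.
  - exact: inv.1.
  - by apply: emeasurable_sum => i; exact: measurable_sqr_vdot.
  - by move=> z; apply: sume_ge0 => i _; rewrite lee_fin sqr_ge0.
  rewrite (eq_integral (cst 1%E)); last first.
    move=> z /set_mem/subsphereP[zz xz] /=; rewrite sumEFin; congr EFin.
    rewrite -zz; apply: eq_bigr => i _.
    by rewrite p_dot xz mulr0 subr0 expr2.
  rewrite integral_cst ?mul1e//; first exact: inv.1.
  exact: measurable_subsphere.
under eq_bigr do rewrite Qp.
rewrite -ge0_sume_distrl; last first.
  by move=> i _; rewrite lee_fin subr_ge0 -xx sqr_tnth_le.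
rewrite sumEFin sumrB sumr_const card_ord.
have -> : \sum_(i < d) tnth x i ^+ 2 = 1.
  by rewrite -xx; apply: eq_bigr => i _; rewrite expr2.
have d1 : (d%:R - 1 : R) != 0 by rewrite subr_eq0 pnatr_eq1; case: (d) d2 => [|[]].
move=> h; rewrite -[LHS]mul1e -[in LHS](mulVf d1) EFinM -muleA h mule1//.
Qed.

End SecondMoment.

(** * Rotations in a plane *)

Section Rotation.
Context {R : realType} {d : nat}.
Local Notation V := (d.-tuple R).
Implicit Types (x y z u v e : V).

Lemma vscale_unit u : vdot u u != 0 ->
  let e := vscale (vnorm u)^-1 u in vdot e e = 1 /\ u = vscale (vnorm u) e.
Proof.
move=> u0 /=; have nu : vnorm u ^+ 2 = vdot u u by rewrite sqr_sqrtr ?vdotvv_ge0.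
have n0 : vnorm u != 0 by rewrite -sqrf_eq0 nu.
split; first by rewrite vdotZl vdotZr -nu; field.
by apply: eq_from_tnth => i; rewrite !tnth_mktuple mulrA divff ?mul1r.
Qed.

(** The squared lengths 1 - x_i^2 of the projected basis vectors sum to d - 1, so one of them is
    nonzero and its vector can be normalized. *)
Lemma exists_unit_orthogonal x : (2 <= d)%N -> vdot x x = 1 ->
  exists2 e, vdot e e = 1 & vdot e x = 0.
Proof.
move=> d2 xx.
have [i xi] : exists i, 1 - tnth x i ^+ 2 != 0.
  apply/existsP; apply: contraT; rewrite negb_exists => /forallP h.
  have : \sum_(i < d) (1 - tnth x i ^+ 2) = 0.
    by apply: big1 => i _; apply/eqP; have := h i; rewrite negbK.
  rewrite sumrB sumr_const card_ord.
  have -> : \sum_(i < d) tnth x i ^+ 2 = 1.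
    by rewrite -xx; apply: eq_bigr => i _; rewrite expr2.
  by move/eqP; rewrite subr_eq0 pnatr_eq1; case: (d) d2 => [|[]].
pose b : V := [tuple (k == i)%:R | k < d].
have bE z : vdot b z = tnth z i.
  rewrite /vdot (bigD1 i)//= tnth_mktuple eqxx mul1r big1 ?addr0// => j ji.
  by rewrite tnth_mktuple (negbTE ji) mul0r.
pose p := vsub b (vscale (tnth x i) x).
have px : vdot p x = 0 by rewrite vdotBl vdotZl bE xx mulr1 subrr.
have pp : vdot p p = 1 - tnth x i ^+ 2.
  rewrite vdotBr vdotZr px mulr0 subr0 vdotC bE !tnth_mktuple eqxx.
  by rewrite expr2.
have [|e1 _] := vscale_unit p; first by rewrite pp.
by eexists; [exact: e1|rewrite vdotZl px mulr0].
Qed.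

Lemma exists_orthonormal_decomposition x y : (2 <= d)%N ->
  vdot x x = 1 -> exists s e, [/\ vdot e e = 1, vdot e x = 0 &
    y = vadd (vscale (vdot x y) x) (vscale s e)].
Proof.
move=> d2 xx.
pose w := vsub y (vscale (vdot x y) x).
have wx : vdot w x = 0 by rewrite vdotBl vdotZl xx mulr1 vdotC subrr.
have yE : y = vadd (vscale (vdot x y) x) w.
  by apply: eq_from_tnth => i; rewrite !tnth_mktuple; ring.
(* If [y] is a multiple of [x], any unit vector orthogonal to [x] serves, with s = 0; otherwise
   normalize [w]. *)
have [w0|w0] := eqVneq (vdot w w) 0.
  have [e e1 ex] := exists_unit_orthogonal x d2 xx.
  have wi i : tnth w i = 0.
    by apply/eqP; rewrite -sqrf_eq0 eq_le sqr_ge0 andbT -w0 sqr_tnth_le.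
  exists 0, e; split => //; rewrite [LHS]yE; apply: eq_from_tnth => i.
  apply: (etrans (tnth_mktuple _ i)).
  by rewrite wi [RHS]tnth_mktuple [tnth (vscale 0 e) i]tnth_mktuple mul0r.
have [e1 we] := vscale_unit w w0.
exists (vnorm w), (vscale (vnorm w)^-1 w); split => //.
  by rewrite vdotZl wx mulr0.
by rewrite -we.
Qed.

Definition geodesic x z (w : R) : V := vadd (vscale (cos w) x) (vscale (sin w) z).

(* For unit vectors, with [e] orthogonal to [x] and [y] in their span, this is
   the rotation of that plane sending [x] to [y]. *)
Definition plane_rotation x y e z : V := reflection (vsub x y) (reflection e z).

(** The rotation moves [z] only within the plane of [x] and [e], so the difference of the endpoints
    lies in that plane. Its two coordinates have squares summing to 2 (1 - c) (cos^2 w + a^2 sin^2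
    w), where 2 (1 - c) = |x - y|^2. *)
Lemma geodesic_rotation_dist x y e s z w :
  vdot x x = 1 -> vdot y y = 1 -> x <> y -> vdot e e = 1 -> vdot e x = 0 ->
  y = vadd (vscale (vdot x y) x) (vscale s e) -> vdot x z = 0 ->
  vnorm (vsub (geodesic x z w) (geodesic y (plane_rotation x y e z) w)) =
  vnorm (vsub x y) * Num.sqrt (cos w ^+ 2 + sin w ^+ 2 * vdot e z ^+ 2).
Proof.
move=> xx yy xy ee ex; set c := vdot x y => yE xz.
have yi i : tnth y i = c * tnth x i + s * tnth e i.
  by rewrite {1}yE !tnth_mktuple.
have cs : c ^+ 2 + s ^+ 2 = 1.
  by rewrite -yy yE !(vdotDl, vdotDr, vdotZl, vdotZr) xx ee (vdotC x e) ex; ring.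
have s2 : s ^+ 2 = 1 - c ^+ 2 by rewrite -[s ^+ 2](addKr (c ^+ 2)) cs addrC.
have nn : vdot (vsub x y) (vsub x y) = 2 * (1 - c).
  by rewrite vdot_sub xx yy -/c; ring.
have c1 : 1 - c != 0.
  apply/eqP => h; apply: xy; apply: vsub_eq0.
  by rewrite nn h mulr0.
set a := vdot e z.
have yz : vdot y z = s * a by rewrite yE vdotDl !vdotZl xz mulr0 add0r.
have ye : vdot y e = s by rewrite yE vdotDl !vdotZl ee (vdotC x) ex mulr0 add0r mulr1.
have Mi i : tnth (plane_rotation x y e z) i =
    tnth z i - a * ((1 - c) * tnth e i + s * tnth x i).
  rewrite /plane_rotation {1}/reflection nn /reflection.
  rewrite !vdotBr !vdotZr !vdotBl xz yz ye ee (vdotC x e) ex -/a.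
  rewrite !tnth_mktuple yi.
  field : s2.
  exact: c1.
have -> : vsub (geodesic x z w) (geodesic y (plane_rotation x y e z) w) =
    vadd (vscale (cos w * (1 - c) + sin w * a * s) x)
         (vscale (sin w * a * (1 - c) - cos w * s) e).
  apply: eq_from_tnth => i; rewrite !(tnth_mktuple, Mi, yi); ring.
rewrite /vnorm -sqrtrM ?vdotvv_ge0// nn; congr Num.sqrt.
rewrite !(vdotDl, vdotDr, vdotZl, vdotZr) xx ee (vdotC x e) ex.
ring : s2.
Qed.

End Rotation.

(** * The uniform angle and the rate *)

Section UniformAngle.
Context {R : realType}.

Lemma twopi_gt0 : 0 < 2 * pi :> R.
Proof. by rewrite mulr_gt0// pi_gt0. Qed.

Lemma measurable_idR : @measurable_fun _ _ (measurableTypeR R) R setT idfun.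
Proof. by move=> _ A mA; rewrite setTI; exact: mA. Qed.

(* [uniform_prob] lives on an alias of [R] that carries another display. *)
Definition uniform_angle : probability R R :=
  distribution (uniform_prob twopi_gt0)
    (HB.pack_for {mfun measurableTypeR R >-> R} (idfun : measurableTypeR R -> R)
      (@isMeasurableFun.Build _ _ (measurableTypeR R) R idfun measurable_idR)).

Lemma integral_uniform_angle_cc (f : R -> \bar R) :
  measurable_fun setT f -> (forall w, 0 <= f w)%E ->
  (\int[uniform_angle]_w f w =
   ((2 * pi)^-1)%:E * \int[lebesgue_measure]_(w in `[0%R, (2 * pi)%R]) f w)%E.
Proof.
move=> mf f0; rewrite ge0_integral_pushforward//.
by rewrite preimage_setT integral_uniform// subr0.
Qed.

(** Removing the null endpoint gives the half-open interval of [gss_kernel] and [gss_rate]. *)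
Lemma integral_uniform_angle (f : R -> \bar R) :
  measurable_fun setT f -> (forall w, 0 <= f w)%E ->
  (\int[uniform_angle]_w f w =
   ((2 * pi)^-1)%:E * \int[lebesgue_measure]_(w in `[0%R, (2 * pi)%R[) f w)%E.
Proof.
move=> mf f0; rewrite integral_uniform_angle_cc//; congr (_ * _)%E.
rewrite -integral_itv_bndo_bndc//.
exact: measurable_funTS.
Qed.

Lemma measurable_sin : measurable_fun setT (@sin R).
Proof. by apply: continuous_measurable_fun; exact: continuous_sin. Qed.

Lemma measurable_cos : measurable_fun setT (@cos R).
Proof. by apply: continuous_measurable_fun; exact: continuous_cos. Qed.

Lemma measurable_sqrt : measurable_fun setT (@Num.sqrt R).
Proof. by apply: continuous_measurable_fun; exact: sqrt_continuous. Qed.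

End UniformAngle.

Section Rate.
Context {R : realType}.

Definition rate_integrand (d : nat) (w : R) : R :=
  Num.sqrt (cos w ^+ 2 + sin w ^+ 2 / (d%:R - 1)).

Lemma measurable_rate_integrand d : measurable_fun setT (rate_integrand d).
Proof.
apply: (measurableT_comp measurable_sqrt); apply: measurable_funD.
  by apply: measurable_funX; exact: measurable_cos.
by apply: measurable_funM => //; apply: measurable_funX; exact: measurable_sin.
Qed.

Lemma gss_rateE d :
  gss_rate d = (\int[uniform_angle]_w (rate_integrand d w)%:E)%E.
Proof.
rewrite integral_uniform_angle//.
- by apply/measurable_EFinP; exact: measurable_rate_integrand.
- by move=> w; rewrite lee_fin sqrtr_ge0.
Qed.

(** As d - 1 >= 2, the integrand is at most sqrt (1 - sin^2 w / 2), which is at most 1 - sin^2 w /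
    4. This bound has an elementary antiderivative. *)
Lemma rate_integrand_le d w : (3 <= d)%N ->
  rate_integrand d w <= 1 - sin w ^+ 2 / 4.
Proof.
move=> d3; have d2 : (2 : R) <= d%:R - 1 by rewrite lerBrDr natr1 ler_nat.
set s := sin w ^+ 2; have s0 : 0 <= s by exact: sqr_ge0.
have sc : cos w ^+ 2 = 1 - s by rewrite /s -(cos2Dsin2 w) addrK.
have s1 : s <= 1 by have := sqr_ge0 (cos w); rewrite sc subr_ge0.
have sd : s / (d%:R - 1) <= s / 2.
  by rewrite ler_wpM2l// lef_pV2 ?posrE //; lra.
rewrite /rate_integrand sc -/s -[leRHS]ger0_norm; last by lra.
by rewrite -sqrtr_sqr ler_wsqrtr//; nra.
Qed.

Lemma gss_rate_lt1 d : (3 <= d)%N -> (gss_rate d < (1%:E : \bar R))%E.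
Proof.
move=> d3; pose f (w : R) := 1 - sin w ^+ 2 / 4.
have mf : measurable_fun setT f.
  apply: measurable_funB => //; apply: measurable_funM => //.
  by apply: measurable_funX; exact: measurable_sin.
have f0 w : 0 <= f w.
  by have := sqr_ge0 (cos w); have := cos2Dsin2 w; rewrite /f; lra.
(* Since sin^2 has mean 1/2, the bound has mean 1 - 1/8. *)
apply: (@le_lt_trans _ _ (7 / 8)%:E); last by rewrite lte_fin; lra.
rewrite gss_rateE.
apply: (@le_trans _ _ (\int[uniform_angle]_w (f w)%:E)%E).
  apply: ge0_le_integral => //.
  - by move=> w _; rewrite lee_fin sqrtr_ge0.
  - by apply/measurable_EFinP; exact: measurable_rate_integrand.
  - exact/measurable_EFinP.
  - by move=> w _; rewrite lee_fin rate_integrand_le.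
rewrite integral_uniform_angle_cc//; last exact/measurable_EFinP.
pose F (w : R) := w - (w - sin w * cos w) / 8.
have dF (w : R) : is_derive w 1 F (f w).
  apply: is_derive_eq.
  by rewrite /f /GRing.scale/=; have := cos2Dsin2 w; lra.
rewrite (@continuous_FTC2 _ f F)//.
- rewrite /F [2 * pi]mulr_natl sin2pi sin0 !mul0r !subr0 -EFinM lee_fin.
  have := pi_gt0 R; move=> p0; rewrite le_eqVlt; apply/orP; left; apply/eqP.
  by field; lra.
- exact: twopi_gt0.
- apply: continuous_subspaceT => w; apply: cvgB; first exact: cvg_cst.
  apply: cvgM; last exact: cvg_cst.
  by apply: cvgM; exact: continuous_sin.
- have cF : continuous F.
    by move=> w; apply: differentiable_continuous; apply/derivable1_diffP; exact: ex_derive.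
  split.
  + by move=> w _; exact: ex_derive.
  + by apply: cvg_at_right_filter; exact: cF.
  + by apply: cvg_at_left_filter; exact: cF.
- by move=> w _; rewrite derive1E; exact: derive_val.
Qed.

End Rate.

(** * The kernel as an image measure, and means over the great subsphere *)

Section Coupling.
Context {R : realType} {d : nat}.
Local Notation V := (d.-tuple R).
Implicit Types (x y z u v e : V) (sigma : V -> probability V R).

Lemma measurable_geodesic dT (T : measurableType dT) x (f : T -> V) (w : T -> R) :
  measurable_fun setT f -> measurable_fun setT w ->
  measurable_fun setT (fun t => geodesic x (f t) (w t)).
Proof.
move=> mf mw; apply: measurable_vadd; apply: measurable_vscale => //.
  exact: measurableT_comp measurable_cos mw.
exact: measurableT_comp measurable_sin mw.
Qed.

Lemma measurable_geodesic_set x (A : set V) : measurable A ->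
  measurable [set p : V * R | A (geodesic x p.1 p.2)].
Proof.
move=> mA; rewrite -[X in measurable X]setTI.
by apply: (measurable_geodesic _ _ x fst snd).
Qed.

(** Writing P(x, .) as the law of the geodesic endpoint for independent z and w lets two kernels be
    coupled by sharing this randomness. *)
Lemma gss_kernelE sigma x (A : set V) : measurable A ->
  gss_kernel sigma x A =
  (sigma x \x uniform_angle)%E [set p : V * R | A (geodesic x p.1 p.2)].
Proof.
move=> mA; have mK := measurable_geodesic_set x A mA.
set K := [set p | _] in mK *.
rewrite /gss_kernel [RHS]/product_measure1.
have E z : (\int[lebesgue_measure]_(w in `[0%R, (2 * pi)%R[)
    (\1_A (geodesic x z w) : R)%:E =
    (2 * pi)%:E * (uniform_angle \o xsection K) z)%E.
  have := @integral_uniform_angle R (fun w => (\1_(xsection K z) w : R)%:E).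
  rewrite integral_indic//=; last exact: measurable_xsection.
  rewrite setIT => ->; last 2 first.
  - by apply/measurable_EFinP; apply: measurable_indic; exact: measurable_xsection.
  - by move=> w; rewrite lee_fin.
  rewrite muleA -EFinM divff ?mul1e; last by rewrite gt_eqF// twopi_gt0.
  apply: eq_integral => w _; rewrite !indicE; congr (_%:R%:E).
  by rewrite mem_xsection.
under eq_integral do rewrite E.
rewrite ge0_integralZl//.
- by rewrite muleA -EFinM mulVf ?mul1e// gt_eqF// twopi_gt0.
- exact: measurable_fun_xsection.
- by rewrite lee_fin ltW// twopi_gt0.
Qed.

Lemma reflection_invariant_sphere sigma x :
  normalized_subsphere_measures sigma -> sphere x -> reflection_invariant x (sigma x).
Proof.
move=> hsigma Sx; have [s1 inv] := hsigma x Sx; split => // n nx A mA.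
have [M MM ME] := reflection_mxapply n.
rewrite -(inv M MM _ A mA); last by rewrite ME reflection_fix.
by congr (sigma x _); apply/seteqP; split => u /=; rewrite ME.
Qed.

Lemma integral_affine_moment (mu : probability V R) x e (a b : R) :
  (2 <= d)%N -> reflection_invariant x mu ->
  vdot x x = 1 -> vdot e x = 0 -> vdot e e = 1 -> 0 <= a -> 0 <= b ->
  (\int[mu]_z (a + b * vdot e z ^+ 2)%:E = (a + b / (d%:R - 1))%:E)%E.
Proof.
move=> d2 inv xx ex ee a0 b0.
have q0 z : (0 <= (vdot e z ^+ 2)%:E)%E by rewrite lee_fin sqr_ge0.
under eq_integral do rewrite EFinD EFinM.
rewrite ge0_integralD//; last 2 first.
- by move=> z _; rewrite mule_ge0.
- by apply: measurable_funeM; exact: measurable_sqr_vdot.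
rewrite ge0_integralZl//; last exact: measurable_sqr_vdot.
rewrite (second_moment mu x e)// integral_cst//
  [X in (_ * X + _)%E](_ : _ = 1%E) ?mule1; last exact: probability_setT.
by rewrite EFinD EFinM.
Qed.

Lemma integral_sqrt_moment_le (mu : probability V R) x e (a b : R) :
  (2 <= d)%N -> reflection_invariant x mu ->
  vdot x x = 1 -> vdot e x = 0 -> vdot e e = 1 -> 0 <= a -> 0 <= b ->
  0 < a + b ->
  (\int[mu]_z (Num.sqrt (a + b * vdot e z ^+ 2))%:E <=
   (Num.sqrt (a + b / (d%:R - 1)))%:E)%E.
Proof.
move=> d2 inv xx ex ee a0 b0 ab.
have d1 : 0 < (d%:R - 1)^-1 :> R by rewrite invr_gt0 subr_gt0 ltr1n.
set c := (d%:R - 1)^-1 in d1 *.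
set t := a + b * c.
(* The tangent to the square root at [t] needs t > 0. *)
have t0 : 0 < t.
  have [b_0|b1] := eqVneq b 0; first by rewrite /t b_0 mul0r addr0; lra.
  by apply: ltr_wpDl => //; rewrite mulr_gt0// lt_neqAle eq_sym b1.
set s := Num.sqrt t; have s0 : 0 < s by rewrite sqrtr_gt0.
have ss : s ^+ 2 = t by rewrite sqr_sqrtr// ltW.
have s2 : 0 <= (2 * s)^-1 by rewrite invr_ge0 mulr_ge0// ltW.
(* Jensen's inequality for the square root, through its tangent at [t] *)
have tangent r : 0 <= r -> Num.sqrt r <= (r + t) * (2 * s)^-1.
  move=> r0; rewrite ler_pdivlMr ?mulr_gt0// -[X in _ <= X + _](sqr_sqrtr r0) -ss.
  by have := sqr_ge0 (Num.sqrt r - s); lra.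
(* At r = a + b <e, z>^2 the tangent is affine in <e, z>^2. Its mean is (t + t) / (2 s) = s by the
   second moment. *)
apply: (@le_trans _ _ (\int[mu]_z
    ((a + t) * (2 * s)^-1 + (b * (2 * s)^-1) * vdot e z ^+ 2)%:E)%E).
  apply: ge0_le_integral => //.
  - apply/measurable_EFinP; apply: (measurableT_comp measurable_sqrt).
    apply: measurable_funD => //; apply: measurable_funM => //.
    by apply: measurable_funX; exact: measurable_vdot.
  - apply/measurable_EFinP; apply: measurable_funD => //; apply: measurable_funM => //.
    by apply: measurable_funX; exact: measurable_vdot.
  - move=> z _; rewrite lee_fin; apply: le_trans (tangent _ _) _.
      by rewrite addr_ge0// mulr_ge0// sqr_ge0.
    by rewrite le_eqVlt; apply/orP; left; apply/eqP; ring.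
rewrite (integral_affine_moment mu x e)//; last 2 first.
- by rewrite mulr_ge0// addr_ge0// ltW.
- by rewrite mulr_ge0.
rewrite lee_fin -/c le_eqVlt; apply/orP; left; apply/eqP.
rewrite (_ : _ + _ = (t + t) * (2 * s)^-1); last by rewrite /t; ring.
by rewrite -ss; field; rewrite gt_eqF.
Qed.

End Coupling.

(** * The coupling *)

Section Contraction.
Context {R : realType} {d : nat}.
Local Notation V := (d.-tuple R).
Implicit Types (x y z u v e : V) (sigma : V -> probability V R).

Lemma measurable_plane_rotation dT (T : measurableType dT) x y e (f : T -> V) :
  measurable_fun setT f -> measurable_fun setT (fun t => plane_rotation x y e (f t)).
Proof. by move=> mf; apply: measurable_reflection; exact: measurable_reflection. Qed.

(** The reflection along [e] preserves [mu] because [e] is orthogonal to [x]; the one along [x - y]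
    then carries [mu] to [nu]. *)
Lemma plane_rotation_transport x y e (mu nu : probability V R) :
  vdot x x = vdot y y -> vdot e x = 0 ->
  reflection_invariant x mu -> reflection_invariant y nu ->
  forall A, measurable A -> mu (plane_rotation x y e @^-1` A) = nu A.
Proof.
move=> xy ex imu inu A mA; rewrite -(reflection_transport x y mu nu)//.
rewrite -[RHS](imu.2 e ex)//.
by rewrite -[X in measurable X]setTI; exact: measurable_reflection.
Qed.

Lemma gss_kernel_rotated sigma x y e (A : set V) :
  vdot x x = vdot y y -> vdot e x = 0 ->
  reflection_invariant x (sigma x) -> reflection_invariant y (sigma y) ->
  measurable A -> gss_kernel sigma y A =
  (sigma x \x uniform_angle)%E
    [set p : V * R | A (geodesic y (plane_rotation x y e p.1) p.2)].
Proof.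
move=> xy ex ix iy mA; rewrite gss_kernelE// /product_measure1.
set K := [set p | _].
have mK : measurable K by exact: measurable_geodesic_set.
have mM : measurable_fun setT (plane_rotation x y e : V -> V).
  exact: measurable_plane_rotation.
transitivity (\int[pushforward (sigma x) (plane_rotation x y e)]_z
    (uniform_angle \o xsection K) z)%E.
  by apply: eq_measure_integral => B mB _; symmetry; exact: plane_rotation_transport.
rewrite ge0_integral_pushforward//; exact: measurable_fun_xsection.
Qed.

Lemma wasserstein_gss_le sigma x y : (2 <= d)%N ->
  normalized_subsphere_measures sigma -> sphere x -> sphere y -> x <> y ->
  (wasserstein (gss_kernel sigma x) (gss_kernel sigma y) <=
   (vnorm (vsub x y))%:E * gss_rate d)%E.
Proof.
move=> d2 hsigma Sx Sy xy.
have ix := reflection_invariant_sphere sigma x hsigma Sx.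
have iy := reflection_invariant_sphere sigma y hsigma Sy.
have xx : vdot x x = 1 by exact/vnorm1.
have yy : vdot y y = 1 by exact/vnorm1.
have [s [e [ee ex yE]]] := exists_orthonormal_decomposition x y d2 xx.
(* Both endpoints use the same angle and the same [z], rotated for the second; the law of the pair
   is the coupling. *)
pose f (p : V * R) : V * V :=
  (geodesic x p.1 p.2, geodesic y (plane_rotation x y e p.1) p.2).
have mf : measurable_fun setT f.
  apply: measurable_fun_pair; apply: measurable_geodesic => //.
  exact: measurable_plane_rotation.
pose m := (sigma x \x uniform_angle)%E.
have m1 : (m setT = 1)%E.
  rewrite /m -setXTT product_measure1E// -[RHS]mule1.
  by congr (_ * _)%E; exact: probability_setT.
pose P : probability (V * R)%type R := HB.pack m (Measure_isProbability.Build _ _ _ m m1).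
pose F : {mfun (V * R)%type >-> (V * V)%type} := HB.pack f (isMeasurableFun.Build _ _ _ _ f mf).
apply: ereal_inf_le.
exists (\int[distribution P F]_p (vnorm (vsub p.1 p.2))%:E)%E.
  exists (distribution P F) => // A mA; split.
    rewrite gss_kernelE//; change (m (f @^-1` (A `*` setT)) =
      m [set p | A (geodesic x p.1 p.2)]).
    by congr (m _); apply/seteqP; split => p; [case|split].
  rewrite (gss_kernel_rotated sigma x y e)// ?xx//.
  change (m (f @^-1` (setT `*` A)) =
      m [set p | A (geodesic y (plane_rotation x y e p.1) p.2)]).
  by congr (m _); apply/seteqP; split => p; [case|split].
have mn : measurable_fun setT (fun p : V * V => (vnorm (vsub p.1 p.2))%:E).
  apply/measurable_EFinP; apply: (measurableT_comp measurable_sqrt).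
  by apply: measurable_vdot; exact: measurable_vsub.
rewrite ge0_integral_pushforward//; last by move=> p _; rewrite lee_fin sqrtr_ge0.
rewrite preimage_setT.
(* With [z] as the inner variable, the square root bound applies at each fixed angle. *)
rewrite fubini_tonelli2; last 2 first.
- exact: measurableT_comp mn mf.
- by move=> p; rewrite lee_fin sqrtr_ge0.
rewrite gss_rateE -ge0_integralZl//; last 3 first.
- by apply/measurable_EFinP; exact: measurable_rate_integrand.
- by move=> w _; rewrite lee_fin sqrtr_ge0.
- by rewrite lee_fin sqrtr_ge0.
apply: ge0_le_integral => //.
- by move=> w _; apply: integral_ge0 => z _; rewrite lee_fin sqrtr_ge0.
- apply: measurable_fun_fubini_tonelli_G; first exact: measurableT_comp mn mf.
  by move=> p; rewrite lee_fin sqrtr_ge0.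
- by apply: measurable_funeM; apply/measurable_EFinP; exact: measurable_rate_integrand.
move=> w _; rewrite /fubini_G -EFinM.
have mS := measurable_subsphere x.
pose g z := Num.sqrt (cos w ^+ 2 + sin w ^+ 2 * vdot e z ^+ 2).
have mg : measurable_fun setT (fun z : V => (g z)%:E).
  apply/measurable_EFinP; apply: (measurableT_comp measurable_sqrt).
  apply: measurable_funD => //; apply: measurable_funM => //.
  by apply: measurable_funX; exact: measurable_vdot.
(* The distance formula requires [z] orthogonal to [x], so both integrals are first restricted to
   the subsphere, which has full mass. *)
have -> : (\int[sigma x]_z ((fun p : V * V => (vnorm (vsub p.1 p.2))%:E) \o f) (z, w) =
    \int[sigma x]_z ((vnorm (vsub x y))%:E * (g z)%:E))%E.
  rewrite (integral_full _ (subsphere x))//; last 3 first.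
  - exact: ix.1.
  - exact: measurableT_comp (measurableT_comp mn mf) (measurable_pair2 w).
  - by move=> z; rewrite lee_fin sqrtr_ge0.
  rewrite [RHS](integral_full _ (subsphere x))//; last 3 first.
  - exact: ix.1.
  - exact: measurable_funeM.
  - by move=> z; rewrite -EFinM lee_fin mulr_ge0 ?sqrtr_ge0.
  apply: eq_integral => z /set_mem/subsphereP[_ xz] /=.
  by rewrite (geodesic_rotation_dist x y e s z w).
rewrite ge0_integralZl//; last 2 first.
- by move=> z _; rewrite lee_fin sqrtr_ge0.
- by rewrite lee_fin sqrtr_ge0.
rewrite EFinM lee_wpmul2l ?lee_fin ?sqrtr_ge0//.
apply: (integral_sqrt_moment_le (sigma x) x e); rewrite ?sqr_ge0//.
by rewrite cos2Dsin2.
Qed.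

End Contraction.

Theorem theorem1 (R : realType) (d : nat) (hd : (3 <= d)%N)
    (sigma : d.-tuple R -> probability (d.-tuple R) R)
    (hsigma : normalized_subsphere_measures sigma) :
  wasserstein_contractive (gss_kernel sigma) (gss_rate d).
Proof.
split; last exact: gss_rate_lt1.
apply: ge_ereal_sup => _ [x [y [Sx [Sy [xy ->]]]]].
have n0 : 0 < vnorm (vsub x y).
  rewrite lt_neqAle sqrtr_ge0 andbT eq_sym sqrtr_eq0 -ltNge lt_neqAle vdotvv_ge0 andbT.
  by apply/eqP => /esym/vsub_eq0.
rewrite lee_pdivrMr// muleC.
exact: wasserstein_gss_le (ltnW hd) hsigma Sx Sy xy.
Qed.
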